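(* Let $m, n, r, c$ be positive integers. Suppose that $C_m^r$ has Property D with respect to $c$ and that $C_n^r$ has Property D0 with respect to $c$. If $\mathsf{s}(C_n^r) \le c(n-1)+n+1$, $$n \ge (c-1)^2+1 \quad\text{and}\quad m \ge \frac{(c(n-1)+n)(n-1)(n^r-(c-1))-(c-1)^2}{n-(c-1)^2},$$ then $$\mathsf{s}(C_{mn}^r) \le c(mn-1)+1.$$
   Context: $C_n$ denotes a cyclic group with $n$ elements, written additively, and $C_n^r$ is the direct sum of $r$ copies of $C_n$. A sequence over a finite abelian group $G$ is a finite unordered sequence of elements of $G$ with repetition allowed (a finite multiset), written multiplicatively as $S=g_1\cdot\ldots\cdot g_l$; its length is $|S|=l$ and its sum is $g_1+\dots+g_l$; it is a zero-sum sequence if its sum is $0$. A subsequence is a sub-multiset. Products of sequences are concatenations (multiset unions), and $T^k$ is the concatenation of $k$ copies of $T$. For a finite abelian group $G$, $\mathsf{s}(G)$ is the smallest positive integer $l$ such that every sequence $S$ over $G$ of length $|S|\ge l$ has a zero-sum subsequence $T$ of length $|T|=\exp(G)$. Property D: $G=C_n^r$ has Property D if every sequence $S$ over $G$ of length $|S|=\mathsf{s}(G)-1$ that has no zero-sum subsequence of length $n$ has the form $S=T^{n-1}$ for some sequence $T$ over $G$. $G=C_n^r$ has Property D with respect to $c$ if it has Property D and $\mathsf{s}(G)=c(n-1)+1$ (so that $c=|T|$). Property D0 with respect to $c$: $G=C_n^r$ has this property if every sequence over $G$ of the form $gT^{n-1}$, where $g\in G$ and $T$ is a sequence over $G$ of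 length $|T|=c$, has a zero-sum subsequence of length $n$. *)

(* Defs.v *)
From HB Require Import structures.
From mathcomp Require Import all_boot all_order all_fingroup all_algebra.
From mathcomp Require Import all_solvable finmap multiset boolp.

Set Implicit Arguments.
Unset Strict Implicit.
Unset Printing Implicit Defensive.

Import GRing.Theory.

Local Open Scope mset_scope.

(* For n >= 1, 'I_n.-1.+1 is the additive group Z/nZ. The type 'Z_n is avoided
   because 'Z_1 is Z/2Z, whereas 'I_1 is the trivial group. *)
Definition Cnr (n r : nat) : finZmodType := 'rV['I_n.-1.+1]_r.

(* T^k for a sequence T over G, i.e. a multiset *)
Definition mset_pow (G : finZmodType) (T : {mset G}) (k : nat) : {mset G} :=
  iter k (msetD T) mset0.

Definition has_zero_sum_subseq (G : finZmodType) (k : nat) (S : {mset G}) : Prop :=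
  exists T : {mset G}, [/\ T `<=` S, size T = k & (\sum_(g <- T) g = 0)%R].

Definition s_bound (G : finZmodType) (l : nat) : Prop :=
  0 < l /\ forall S : {mset G}, l <= size S ->
    has_zero_sum_subseq (exponent [set: G]) S.

Lemma s_bound_ex (G : finZmodType) : exists l, `[< s_bound G l >].
Proof.
set e := exponent [set: G].
exists (#|G| * e).+1; apply/asboolP; split=> // S leS.
case: (pselect (exists x, e <= S x)) => [[x le_e]|noS].
  exists (msetn e x); split.
  - apply/msubsetP => y; rewrite msetnE; case: eqP => [->|] //.
  - by rewrite enum_msetn size_nseq.
  - rewrite enum_msetn big_nseq iter_addr_0 -FinRing.zmodXgE.
    exact: (expg_exponent (in_setT x)).
have S_le x : S x <= e.
  by rewrite leqNgt; apply/negP => /ltnW le_e; apply: noS; exists x.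
exfalso; move: leS; rewrite ltnNge => /negP; apply.
rewrite -sum1_size sum_mset.
apply: (@leq_trans (\sum_(i <- finsupp S) e)).
  by apply: leq_sum => i _; rewrite muln1 S_le.
rewrite big_const_seq count_predT iter_addn addn0 mulnC leq_mul2r.
apply/orP; right.
have /card_uniqP <- : uniq (finsupp S) by exact: fset_uniq.
exact: max_card.
Qed.

Definition s (G : finZmodType) : nat := ex_minn (s_bound_ex G).

Definition property_D (n r : nat) : Prop :=
  forall S : {mset Cnr n r}, size S = s (Cnr n r) - 1 ->
    ~ has_zero_sum_subseq n S ->
    exists T : {mset Cnr n r}, S = mset_pow T (n - 1).

Definition property_D_wrt (n r c : nat) : Prop :=
  property_D n r /\ s (Cnr n r) = c * (n - 1) + 1.

Definition property_D0_wrt (n r c : nat) : Prop :=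
  forall (g : Cnr n r) (T : {mset Cnr n r}), size T = c ->
    has_zero_sum_subseq n (g +` mset_pow T (n - 1)).

(* Main.v *)
(* Write G = C_{mn}^r, let phi : G -> C_n^r be the reduction mod n, and identify
   ker phi with C_m^r via psi.  A piece is a list of n elements of G whose sum
   lies in ker phi, and its color is psi of that sum.  A sequence S of length
   c(mn-1)+1 without zero-sum subsequence of length mn has at most c(m-1)
   disjoint pieces, and when it has exactly c(m-1), Property D makes the
   multiplicity of every color divisible by m-1.

   A fibre of phi with mn+(c-1)(m-1) elements of S contains a zero-sum
   subsequence of length mn, so the lower bound on m forces at least c big
   classes, i.e. fibres with at least (c(n-1)+n)(n-1) elements of S.  Exchanging
   elements between two pieces inside a big class preserves the colors, whence
   all but one of the elements of S used there are equal to some z_h.  By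
   counting, some c big classes h have distinct colors n z_h.  For these,
   T = h_1 ... h_c is such that T^{n-1} has no zero-sum subsequence W of length
   n: otherwise n pieces z_h^n, with h running through W, could be replaced by n
   copies of the piece lying over W, changing the multiplicity of some color by
   less than m-1.  Hence the zero-sum subsequence of g T^{n-1} given by Property
   D0 always contains g, so every element outside the big classes can be
   absorbed in a piece using at most n-1 elements of each big class, and cutting
   the rest of the big classes into pieces leaves at most c(n-1) elements,
   which gives c(m-1)+1 pieces.  When n <= 2, D0 directly yields c(m-1)+1 pieces. *)

From HB Require Import structures.
Require Import Defs.
From mathcomp Require Import all_boot all_order all_fingroup all_algebra.
From mathcomp Require Import all_solvable finmap multiset boolp zify.

Set Implicit Arguments.
Unset Strict Implicit.
Unset Printing Implicit Defensive.

Import GRing.Theory.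

(** * Arithmetic of the hypotheses *)

(* Here c = d.+1 and q stands for n ^ r. *)
Section Bounds.
Variables n d : nat.
(* At most d.+1 * (n - 1) + n leftover elements have to be absorbed, each of
   them consuming at most n - 1 elements of a big class. *)
Let M := (d.+1 * (n - 1) + n) * (n - 1).
Hypothesis n_gt2 : 2 < n.

Lemma d_le_sqr : d <= d ^ 2.
Proof. by case: d => // k; rewrite -mulnn leq_pmulr. Qed.

Lemma threshold_ge : 2 * (d.+1 * n + n - d.+1) <= M.
Proof.
rewrite mulnC /M leq_mul //; last by lia.
have : d.+1 <= d.+1 * n by rewrite leq_pmulr //; lia.
by rewrite mulnBr muln1; lia.
Qed.

Lemma threshold_ge_sqr : n * n <= M.
Proof.
apply: (@leq_trans ((2 * n - 1) * (n - 1))).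
  by case: n n_gt2 => [|[|[|k]]] // _; nia.
have : n - 1 <= d.+1 * (n - 1) by rewrite leq_pmull.
by rewrite /M leq_mul2r => le; apply/orP; right; lia.
Qed.

Variables m q : nat.
Hypotheses (d_lt : d ^ 2 < n) (n_le : n <= q) (m_gt0 : 0 < m).
Hypothesis m_ge : M * (q - d) + d ^ 2 * m <= m * n + d ^ 2.

Lemma threshold_le : M <= m * n.
Proof.
have := d_le_sqr; have : d ^ 2 <= d ^ 2 * m by rewrite leq_pmulr.
have : M <= M * (q - d) by rewrite leq_pmulr // subn_gt0; have := d_le_sqr; lia.
by lia.
Qed.

Lemma n_lt_m : n < m.
Proof.
rewrite -(ltn_pmul2r (m := n)); last by lia.
apply: leq_trans threshold_le; apply: (@leq_trans ((2 * n - 1) * (n - 1))).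
  by case: n n_gt2 => [|[|[|k]]] // _; nia.
have : n - 1 <= d.+1 * (n - 1) by rewrite leq_pmull.
by rewrite /M leq_mul2r => le; apply/orP; right; lia.
Qed.

(** Worst case for the length of S: [b] big classes hold at most [X] elements each, the other
    [q - b] classes at most [M - 1]. As [M - 1 <= X], the case [b = d] dominates, and there [m_ge]
    keeps the total below the length of S. Hence more than [d] classes are big. *)
Lemma many_big_classes b X : X = m * n - 1 + d * (m - 1) -> b <= d ->
  b * X + (q - b) * (M - 1) < d.+1 * (m * n - 1) + 1.
Proof.
move=> XE bd; have dq := d_le_sqr; have MX : M - 1 <= X.
  by rewrite XE; apply: leq_trans (leq_addr _ _); rewrite leq_sub2r // threshold_le.
apply: (@leq_ltn_trans (d * X + (q - d) * (M - 1))).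
  have -> : q - b = (d - b) + (q - d) by lia.
  have -> : d * X = b * X + (d - b) * X by rewrite -mulnDl subnKC.
  by rewrite mulnDl addnA leq_add2r leq_add2l leq_mul2l MX orbT.
have M0 : 0 < M by have := threshold_ge_sqr; nia.
have -> : (q - d) * (M - 1) = M * (q - d) - (q - d) by rewrite mulnBr muln1 mulnC.
have : q - d <= M * (q - d) by rewrite leq_pmull.
have mn0 : 0 < m * n by rewrite muln_gt0 m_gt0; lia.
have -> : d * X = d * (m * n) - d + (d ^ 2 * m - d ^ 2).
  by rewrite XE mulnDr mulnA mulnn !mulnBr !muln1.
have : d ^ 2 <= d ^ 2 * m by rewrite leq_pmulr.
have : d <= d * (m * n) by rewrite leq_pmulr.
rewrite [in ltnRHS]mulnBr muln1 mulSn; lia.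
Qed.

(** Bounds the elements outside [b] big classes plus two pieces per big class. One more big class
    adds [2 * n] but removes [M - 1 >= 2 * n], so [b = d.+1] is the worst case; there one summand
    [M] of [m_ge] pays for the pieces, by [threshold_ge]. *)
Lemma few_small_classes b : d.+1 <= b -> b <= q ->
  (q - b) * (M - 1) + 2 * b * n < (m - 1) * n.
Proof.
move=> db bq; have dq := d_le_sqr; have T := threshold_ge; have T2 := threshold_ge_sqr.
have nm := n_lt_m.
have M2n : 2 * n <= M - 1 by have : 3 * n <= n * n by [rewrite leq_mul2r n_gt2 orbT]; lia.
apply: (@leq_ltn_trans ((q - d.+1) * (M - 1) + 2 * d.+1 * n)).
  have [e bE] : exists e, b = d.+1 + e by exists (b - d.+1); lia.
  have -> : q - d.+1 = (q - b) + e by lia.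
  have -> : 2 * b * n = 2 * d.+1 * n + e * (2 * n).
    by rewrite bE mulnDr mulnDl (mulnC 2 e) mulnA.
  have : e * (2 * n) <= e * (M - 1) by rewrite leq_mul2l M2n orbT.
  by rewrite [((q - b) + _) * _]mulnDl; lia.
have -> : (q - d.+1) * (M - 1) = M * (q - d.+1) - (q - d.+1) by rewrite mulnBr muln1 mulnC.
have aM : q - d.+1 <= M * (q - d.+1) by rewrite leq_pmull //; lia.
have cn : d.+1 <= d.+1 * n by rewrite leq_pmulr //; lia.
have nmn : n <= m * n by rewrite leq_pmull.
have m4 : d ^ 2 * 4 <= d ^ 2 * m by rewrite leq_mul2l; apply/orP; right; lia.
move: m_ge; have -> : q - d = (q - d.+1).+1 by lia.
rewrite mulnS mulnBl mul1n -mulnA; lia.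
Qed.
End Bounds.

(** * Sublists up to permutation *)

Section Lists.
Variables T U : eqType.
Implicit Types s t u : seq T.

Lemma count_submset s t : (forall x, count_mem x t <= count_mem x s) ->
  exists u, perm_eq s (t ++ u).
Proof.
move=> /count_subseqP[t' /subseqP[msk sz_msk ->] tP].
exists (mask (map negb msk) s); apply/seq.permP => a.
rewrite count_cat (seq.permP tP); elim: s msk sz_msk {tP t} => [|x s IH] [|b msk] //= [sz].
by rewrite (IH msk sz); case: b => /=; lia.
Qed.

(** Serves to lift a zero-sum sublist found among images back to the elements themselves. *)
Lemma perm_map_catE (f : T -> U) s (t u : seq U) : perm_eq (map f s) (t ++ u) ->
  exists s1 s2, [/\ perm_eq s (s1 ++ s2), map f s1 = t & map f s2 = u].
Proof.
elim: t s => [|y t IH] s /= sP.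
  case: s sP => [|x0 s] sP.
    by rewrite perm_sym in sP; move/perm_nilP: sP => ->; exists [::], [::].
  move: sP; rewrite perm_sym => /(perm_iotaP (f x0))[I IP ->].
  rewrite size_map in IP.
  exists [::], (map (nth x0 (x0 :: s)) I); split=> //=.
    by rewrite perm_sym; apply/(perm_iotaP x0); exists I.
  rewrite -map_comp; apply/eq_in_map => i; rewrite (perm_mem IP) mem_iota => /andP[_ ltis].
  by rewrite /= -(nth_map x0 (f x0)).
have: y \in map f s by rewrite (perm_mem sP) mem_head.
move=> /mapP[x xs yE]; have xP := perm_to_rem xs.
have [|s1 [s2 [remP <- <-]]] := IH (rem x s).
  rewrite -(perm_cons y) -(permPr sP) yE -map_cons perm_sym.
  exact: perm_map.
by exists (x :: s1), s2; rewrite yE (permPl xP) perm_cons.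
Qed.

Lemma size_flatten_const (k : nat) (ps : seq (seq T)) :
  (forall p, p \in ps -> size p = k) -> size (flatten ps) = size ps * k.
Proof.
elim: ps => //= p ps IH psP; rewrite size_cat IH ?psP ?mem_head ?mulSn // => q qps.
by apply: psP; rewrite in_cons qps orbT.
Qed.

Lemma chunks (k l : nat) s : size s = l * k ->
  exists ps, [/\ s = flatten ps, size ps = l & forall p, p \in ps -> size p = k].
Proof.
elim: l s => [|l IH] s sz.
  by exists [::]; split=> //; apply/nilP; rewrite /nilp sz.
have [|ps [dE psl psP]] := IH (drop k s); first by rewrite size_drop sz mulSn addKn.
exists (take k s :: ps); split=> /= [||p]; rewrite ?psl -?dE ?cat_take_drop //.
by rewrite in_cons => /predU1P[->|/psP //]; rewrite size_takel // sz mulSn leq_addr.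
Qed.

Lemma size_flatten_le (k : nat) (ps : seq (seq T)) :
  (forall p, p \in ps -> size p <= k) -> size (flatten ps) <= size ps * k.
Proof.
elim: ps => //= p ps IH psP; rewrite size_cat mulSn leq_add ?psP ?mem_head // IH // => q qps.
by apply: psP; rewrite in_cons qps orbT.
Qed.

Lemma greedy (good : seq T -> Prop) (k q : nat) : 0 < k ->
  (forall s, q < size s -> exists t u, [/\ perm_eq s (t ++ u), size t = k & good t]) ->
  forall s, exists ps r, [/\ perm_eq s (flatten ps ++ r),
    (forall p, p \in ps -> size p = k /\ good p) & size r <= q].
Proof.
move=> k_gt0 ex s; have [n] := ubnP (size s).
elim: n s => // n IH s ltn; have [lesq|ltqs] := leqP (size s) q.
  by exists [::], s.
have [t [u [sP tk tg]]] := ex s ltqs.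
have := perm_size sP; rewrite size_cat => sz.
have [|ps [r [uP psP rq]]] := IH u; first by lia.
exists (t :: ps), r; split=> // [|p].
  by rewrite /= (permPl sP) -catA perm_cat2l.
by rewrite in_cons => /predU1P[->|/psP].
Qed.

Lemma size_le_count_subset s u k : {subset s <= u} ->
  (forall x, count_mem x s <= k) -> size s <= k * size u.
Proof.
elim: u s => [|x u IH] s su sk.
  by case: s su {sk} => // x s /(_ x); rewrite mem_head in_nil => /(_ isT).
rewrite -(count_predC (pred1 x)) /= mulnS leq_add // -size_filter.
apply: IH => [y|y]; last first.
  by rewrite count_filter; apply: leq_trans (sk y); apply: sub_count => z /andP[].
rewrite mem_filter => /andP[/= yx /su]; rewrite in_cons (negPf yx) //.
Qed.

Lemma perm_fibers (f : T -> U) s (hs : seq U) : uniq hs ->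
  perm_eq s (filter (fun x => f x \notin hs) s ++
             flatten [seq filter (fun x => f x == h) s | h <- hs]).
Proof.
elim: hs => [_|h hs IH /= /andP[hhs uhs]].
  by rewrite cats0 (eq_filter (a2 := predT)) ?filter_predT.
apply: (perm_trans (IH uhs)); rewrite [X in perm_eq _ X]catA perm_cat2r.
set s0 := filter _ s.
pose p x := f x != h.
apply: (perm_trans (y := filter p s0 ++ filter (predC p) s0)).
  by rewrite perm_sym perm_filterC.
rewrite /s0 -!filter_predI; apply/seq.permP => a; rewrite !count_cat !count_filter.
congr (_ + _); apply: eq_count => x /=; rewrite ?inE.
  by rewrite negb_or andbA.
by rewrite negbK; case: eqP => [->|]; rewrite ?hhs ?andbT ?andbF.
Qed.

Lemma perm_nseq_count (s : seq T) x k : k <= count_mem x s ->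
  exists u, perm_eq s (nseq k x ++ u).
Proof.
move=> le; apply: count_submset => y; rewrite count_nseq /=.
by case: eqP => [<-|]; rewrite ?mul1n ?mul0n.
Qed.

Lemma uniq_map_inj_in (f : T -> U) s : uniq (map f s) -> {in s &, injective f}.
Proof.
elim: s => //= x s IH /andP[fx /IH inj] y z; rewrite !in_cons.
move=> /predU1P[->|ys] /predU1P[->|zs] //; last exact: inj.
  by move=> fE; rewrite fE map_f in fx.
by move=> fE; rewrite -fE map_f in fx.
Qed.

Lemma exists_distinct_images (f : T -> U) s k : k <= size (undup (map f s)) ->
  exists s', [/\ {subset s' <= s}, size s' = k & uniq (map f s')].
Proof.
have [s'' sub sE] : exists2 s', {subset s' <= s} & undup (map f s) = map f s'.
  elim: s => [|x s [s' sub sE]] /=; first by exists [::].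
  case: ifP => _; [exists s' | exists (x :: s')] => //= [y /sub|y|]; last by rewrite sE.
    by rewrite in_cons => ->; rewrite orbT.
  by rewrite !in_cons => /predU1P[->|/sub->]; rewrite ?eqxx ?orbT.
rewrite sE size_map => le; exists (take k s''); split; first by move=> y /mem_take/sub.
  by rewrite size_takel.
by rewrite map_take take_uniq // -sE undup_uniq.
Qed.

(** If some [y] differs from the head [x], the pair (x, y) forces all other entries to equal one
    [z]. There are at least two of these, so the pairs (x, z) and (y, z) can be compared, and [x] or
    [y] is [z] as well. *)
Lemma almost_const s : 3 < size s ->
  (forall (x y u w : T) t, perm_eq s [:: x, y, u, w & t] -> x = y \/ u = w) ->
  exists z, (size s).-1 <= count_mem z s.
Proof.
case: s => [//|x s] /= sz H.
have [|] := boolP (all (pred1 x) s).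
  by rewrite all_count => /eqP sE; exists x; rewrite sE; lia.
move=> /allPn[y ys /= yx].
have sP := perm_to_rem ys; have := perm_size sP.
case: (rem y s) sP => [|z [|w t]] sP /=; [lia|lia|] => szE.
have zE v : v \in w :: t -> v = z.
  move=> vt; have := perm_to_rem vt; set t' := rem _ _ => tP.
  have [|xy|->//] := H x y z v t'; last by move: yx; rewrite xy eqxx.
  by rewrite perm_cons (permPl sP) !perm_cons.
have wz : w = z by apply: zE; rewrite mem_head.
have xsP : perm_eq (x :: s) [:: x, y, z, z & t].
  by rewrite perm_cons (permPl sP) -wz.
have ct : count_mem z t = size t 
  by apply/eqP; rewrite -all_count; apply/allP => v vt; apply/eqP/zE; rewrite in_cons vt orbT.
have [|xz|yz] := H x z y z t.
- rewrite (permPl xsP); apply/seq.permP => a /=; lia.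
- by exists z; have := seq.permP xsP (pred1 z); rewrite /= ct !eqxx xz eqxx; lia.
- by exists z; have := seq.permP xsP (pred1 z); rewrite /= ct !eqxx yz eqxx; lia.
Qed.

End Lists.

(** * Zero-sum sublists of prescribed length *)

Section ZeroSum.
Variable A : zmodType.
Implicit Types s t u : seq A.
Local Open Scope ring_scope.

Definition zero_sum_sub (k : nat) s : Prop :=
  exists t u, [/\ perm_eq s (t ++ u), size t = k & \sum_(x <- t) x = 0].

Lemma zero_sum_sub_cat k s t u : perm_eq s (t ++ u) ->
  zero_sum_sub k t -> zero_sum_sub k s.
Proof.
move=> sP [t1 [t2 [tP sz sum0]]]; exists t1, (t2 ++ u); split=> //.
by rewrite (permPl sP) catA perm_cat2r.
Qed.

Lemma zero_sum_sub_count k s x : x *+ k = 0 -> (k <= count_mem x s)%N ->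
  zero_sum_sub k s.
Proof.
move=> xk /perm_nseq_count[u sP]; exists (nseq k x), u; split=> //.
  by rewrite size_nseq.
by rewrite big_nseq iter_addr_0.
Qed.

(** Greedy extraction of zero-sum sublists of length [k] stops with at most [q] elements left, hence
    yields at least [a] of them. The last hypothesis is |s| > (a - 1)k + q without subtraction. *)
Lemma zero_sum_sub_mul (a k q : nat) s : (0 < k)%N ->
  (forall t, (q < size t)%N -> zero_sum_sub k t) ->
  (a * k + q < size s + k)%N -> zero_sum_sub (a * k) s.
Proof.
move=> k_gt0 ex sz; have [ps [r [sP psP rq]]] := greedy k_gt0 ex s.
have szp : size (flatten ps) = (size ps * k)%N.
  by apply: size_flatten_const => p /psP[].
have := perm_size sP; rewrite size_cat szp => szs.
have le : (a <= size ps)%N.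
  by rewrite -ltnS -(ltn_pmul2r k_gt0) mulSn; simpl in *; lia.
exists (flatten (take a ps)), (flatten (drop a ps) ++ r); split.
- by rewrite catA -flatten_cat cat_take_drop.
- rewrite (@size_flatten_const _ k) ?size_takel // => p /mem_take /psP[] //.
rewrite big_flatten big_seq big1 // => p /mem_take /psP[] //.
Qed.

End ZeroSum.

(** * Pieces and their colors *)

Section Descent.
Variables (G K : zmodType) (H : finZmodType) (phi : {additive G -> H}) (psi : G -> K).
Variables m n c : nat.
Hypotheses (m_gt0 : 0 < m) (n_gt0 : 0 < n).
Local Open Scope ring_scope.
Hypothesis psiD : forall x y, phi x = 0 -> phi y = 0 -> psi (x + y) = psi x + psi y.
Hypothesis psi_inj0 : forall x, phi x = 0 -> psi x = 0 -> x = 0.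
Hypothesis expG : forall x : G, x *+ (m * n) = 0.
Hypothesis expK : forall x : K, x *+ m = 0.
Hypothesis expH : forall x : H, x *+ n = 0.
Hypothesis sK : forall s : seq K, (c * (m - 1) < size s)%N -> zero_sum_sub m s.

Lemma psi_ker0 : psi 0 = 0.
Proof. by apply: (addrI (psi 0)); rewrite -psiD ?raddf0 // !addr0. Qed.

Lemma psi_sum (I : eqType) (r : seq I) (F : I -> G) :
  (forall i, i \in r -> phi (F i) = 0) -> psi (\sum_(i <- r) F i) = \sum_(i <- r) psi (F i).
Proof.
elim: r => [|i r IH] r0; first by rewrite !big_nil psi_ker0.
have r0' j : j \in r -> phi (F j) = 0 by move=> jr; apply: r0; rewrite in_cons jr orbT.
rewrite !big_cons psiD ?IH ?r0 ?mem_head // raddf_sum big_seq big1 // => j /r0' //.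
Qed.

Lemma psi_inj x y : phi x = 0 -> phi y = 0 -> psi x = psi y -> x = y.
Proof.
move=> x0 y0 exy; apply/eqP; rewrite -subr_eq0; apply/eqP; apply: psi_inj0.
  by rewrite raddfB x0 y0 subr0.
by apply: (addIr (psi y)); rewrite -psiD ?subrK ?add0r // raddfB x0 y0 subr0.
Qed.

Definition piece (p : seq G) : Prop := size p = n /\ phi (\sum_(x <- p) x) = 0.
Definition color (p : seq G) : K := psi (\sum_(x <- p) x).

Definition of_class (h : H) : pred G := fun x => phi x == h.

Lemma class_piece h p : size p = n -> all (of_class h) p -> piece p.
Proof.
move=> szp ph; split=> //; rewrite raddf_sum big_seq.
rewrite (eq_bigr (fun=> h)) => [|x /(allP ph)/eqP //].
by rewrite -big_seq big_const_seq count_predT iter_addr_0 szp expH.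
Qed.

(** Subtracting a fixed [x0] moves the fibre into the kernel of [phi], where [psi] and [sK] give [n]
    disjoint zero-sum sublists of length [m]. Undoing the translation adds [m * n] times [x0], which
    is 0. *)
Lemma class_bound h (s : seq G) : all (of_class h) s ->
  (m * n + (c - 1) * (m - 1) <= size s)%N -> zero_sum_sub (m * n) s.
Proof.
case: s => [|x0 s0].
  have mn0 : (0 < m * n)%N by rewrite muln_gt0 m_gt0.
  by rewrite /= leqNgt ltn_addr.
set s := x0 :: s0 => sh szs.
pose f x := psi (x - x0).
have : zero_sum_sub (n * m) (map f s).
  apply: (zero_sum_sub_mul m_gt0 sK); rewrite size_map.
  by rewrite (mulnC n); clear -szs m_gt0; case: c szs => [|c'];
    rewrite ?mul0n ?subSS ?subn0 ?mulSn; simpl in *; lia.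
move=> [t [u [sP tsz t0]]].
have [s1 [s2 [sP' s1t _]]] := perm_map_catE sP.
have s1h x : x \in s1 -> phi (x - x0) = 0.
  move=> xs; have: x \in s by rewrite (perm_mem sP') mem_cat xs.
  move=> /(allP sh)/eqP xh; rewrite raddfB xh.
  by have /(allP sh)/eqP -> := mem_head x0 s0; rewrite subrr.
exists s1, s2; split=> //; first by rewrite -(size_map f) s1t tsz mulnC.
have: \sum_(x <- s1) (x - x0) = 0.
  apply: psi_inj0; first by rewrite raddf_sum big_seq big1.
  by rewrite psi_sum // -(big_map f predT id) s1t.
rewrite big_split /= sumrN big_const_seq count_predT iter_addr_0.
by rewrite -(size_map f) s1t tsz mulnC expG subr0.
Qed.

Lemma greedy_pieces q (X : seq G) :
  (forall s : seq H, (q < size s)%N -> zero_sum_sub n s) ->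
  exists ps r, [/\ perm_eq X (flatten ps ++ r),
  forall p, p \in ps -> piece p & (size r <= q)%N].
Proof.
move=> exH; apply: (@greedy G (fun p => phi (\sum_(x <- p) x) = 0) n _ n_gt0) => s.
rewrite -(size_map phi) => /exH[t [u [sP szt t0]]].
have [s1 [s2 [sP' s1t _]]] := perm_map_catE sP.
exists s1, s2; split=> //; first by rewrite -(size_map phi) s1t.
by rewrite raddf_sum -(big_map phi predT id) s1t.
Qed.

(** * Decompositions into pieces of a sequence without zero-sum subsequence of length [m * n] *)

Section NoZeroSum.
Variable S : seq G.
Hypothesis noS : ~ zero_sum_sub (m * n) S.

Definition decomp (ps : seq (seq G)) (r : seq G) : Prop :=
  perm_eq S (flatten ps ++ r) /\ forall p, p \in ps -> piece p.

Lemma decomp_perm ps qs r : perm_eq ps qs -> decomp ps r -> decomp qs r.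
Proof.
move=> pq [SP psP]; split=> [|p]; last by rewrite -(perm_mem pq); apply: psP.
by rewrite (permPl SP) perm_cat2r perm_flatten.
Qed.

(** Concatenating [m] pieces whose colors sum to 0 gives [m * n] elements whose sum is in the kernel
    of [phi] and is killed by [psi], hence is 0, against [noS]. *)
Lemma decomp_no_zero_sum ps r : decomp ps r -> ~ zero_sum_sub m (map color ps).
Proof.
move=> [SP psP] [t [u [tP tsz t0]]]; apply: noS.
have [p1 [p2 [pP p1t _]]] := perm_map_catE tP.
have p1P p : p \in p1 -> piece p by move=> pp; apply: psP; rewrite (perm_mem pP) mem_cat pp.
exists (flatten p1), (flatten p2 ++ r); split.
- by rewrite (permPl SP) catA perm_cat2r -flatten_cat perm_flatten.
- rewrite (@size_flatten_const _ n) => [|p /p1P[] //].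
  by rewrite -(size_map color) p1t tsz.
rewrite big_flatten; apply: psi_inj0.
  by rewrite raddf_sum big_seq big1 // => p /p1P[].
by rewrite psi_sum => [|p /p1P[] //]; rewrite -(big_map color predT id) p1t.
Qed.

Lemma decomp_size ps r : decomp ps r -> (size ps <= c * (m - 1))%N.
Proof.
move=> dP; rewrite leqNgt; apply/negP => lt; apply: (decomp_no_zero_sum dP).
by apply: sK; rewrite size_map.
Qed.

Lemma decomp_count ps r t : decomp ps r -> (count_mem t (map color ps) <= m - 1)%N.
Proof.
move=> dP; rewrite leqNgt; apply/negP => lt; apply: (decomp_no_zero_sum dP).
by apply: (zero_sum_sub_count (x := t)); rewrite ?expK // (leq_trans _ lt) // subn1 prednK.
Qed.

Lemma decomp_sizeE ps r : decomp ps r -> size S = (size ps * n + size r)%N.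
Proof.
move=> [SP psP]; rewrite (perm_size SP) size_cat (@size_flatten_const _ n) // => p /psP[] //.
Qed.

(** The length of S is c(m - 1)n + c(n - 1) + 1, and [decomp_size] allows at most c(m - 1) pieces.
    The final contradiction is a decomposition violating this bound. *)
Lemma remainder_gt ps r : decomp ps r -> size S = (c * (m * n - 1) + 1)%N ->
  (c * (n - 1) < size r)%N.
Proof.
move=> dP szS; rewrite ltnNge; apply/negP => le; have := decomp_size dP.
rewrite leqNgt => /negP; apply.
rewrite -(ltn_pmul2r n_gt0).
have := decomp_sizeE dP; rewrite szS.
have -> : (m * n - 1 = (m - 1) * n + (n - 1))%N.
  by case: m m_gt0 => // m' _; rewrite mulSn; lia.
by rewrite mulnDr mulnA => szE; simpl in *; lia.
Qed.

Hypothesis szS : size S = (c * (m * n - 1) + 1)%N.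
Hypothesis DK : forall s : seq K, size s = (c * (m - 1))%N -> ~ zero_sum_sub m s ->
  forall t, (m - 1 %| count_mem t s)%N.

Lemma decomp_dvd ps r t : decomp ps r -> size ps = (c * (m - 1))%N ->
  (m - 1 %| count_mem t (map color ps))%N.
Proof.
move=> dP szps; apply: DK; first by rewrite size_map.
exact: decomp_no_zero_sum dP.
Qed.

Lemma dvdn_close (d a b e : nat) : (2 < d)%N -> (a <= 2)%N -> (b <= 2)%N ->
  (d %| a + e)%N -> (d %| b + e)%N -> a = b.
Proof.
move=> d2 a2 b2; wlog le : a b a2 b2 / (a <= b)%N => [wl|] da db.
  by have [/wl|/ltnW/wl] := leqP a b; [|symmetry]; auto.
have : (d %| (b + e) - (a + e))%N by rewrite dvdn_sub.
rewrite subnDr => /dvdn_leq; case: posnP => [|_ /(_ isT)]; lia.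
Qed.

(* Replacing at most two terms of a sequence whose multiplicities are all
   divisible by m - 1 > 2 keeps these divisibilities only if nothing changes. *)
Lemma exchange A B A' B' ps r : (3 < m)%N ->
  decomp [:: A, B & ps] r -> (size ps).+2 = (c * (m - 1))%N ->
  perm_eq (A ++ B) (A' ++ B') -> piece A' -> piece B' ->
  perm_eq [:: color A; color B] [:: color A'; color B'].
Proof.
move=> m3 dP szps ABP A'P B'P.
have dP' : decomp [:: A', B' & ps] r.
  case: dP => [SP psP]; split=> [|p].
    by rewrite (permPl SP) /= catA -!catA catA [X in perm_eq _ X]catA perm_cat2r.
  rewrite !in_cons => /or3P[/eqP->|/eqP->|pps] //; apply: psP.
  by rewrite !in_cons pps !orbT.
apply/allP => t _ /=.
have := decomp_dvd t dP' szps; have := decomp_dvd t dP szps.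
rewrite /= !addnA addn0 => dA dA'; rewrite !addn0; apply/eqP.
by apply: dvdn_close dA dA'; lia.
Qed.

(** * Near-constancy of the elements cut into pieces inside one class *)

Section OneClass.
Variables (h : H) (P : seq G) (k : nat) (ps : seq (seq G)) (r : seq G).
Hypotheses (n_gt1 : (1 < n)%N) (m_gt3 : (3 < m)%N) (k_gt2 : (2 < k)%N).
Hypotheses (SP : perm_eq S (P ++ flatten ps ++ r)) (Ph : all (of_class h) P).
Hypotheses (szP : size P = (k * n)%N) (psP : forall p, p \in ps -> piece p).
Hypothesis szps : (k + size ps)%N = (c * (m - 1))%N.

(* Exchanging x and y between the pieces x :: A and y :: B. *)
Lemma class_swap x y A B Q : perm_eq P (x :: y :: A ++ B ++ Q) ->
  size A = (n - 1)%N -> size B = (n - 1)%N -> size Q = ((k - 2) * n)%N ->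
  x <> y -> \sum_(z <- A) z = \sum_(z <- B) z.
Proof.
move=> PP szA szB szQ xy.
have [qs [QE szqs qsP]] := chunks szQ.
have inP z : z \in x :: y :: A ++ B ++ Q -> of_class h z.
  by rewrite -(perm_mem PP) => /(allP Ph).
have pP p : {subset p <= x :: y :: A ++ B ++ Q} -> size p = n -> piece p.
  by move=> sub szp; apply: (@class_piece h) => //; apply/allP => z /sub /inP.
have pc a C : a \in [:: x; y] -> {subset C <= A ++ B} -> size C = (n - 1)%N -> piece (a :: C).
  move=> axy sub szC; apply: pP => [z|]; last by rewrite /= szC subn1 prednK.
  rewrite in_cons => /predU1P[->|/sub]; last first.
    by rewrite mem_cat => /orP[] zz; rewrite !(inE, mem_cat) zz !orbT.
  by move: axy; rewrite !inE => /orP[] ->; rewrite ?orbT.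
have sA : {subset A <= A ++ B} by move=> z zA; rewrite mem_cat zA.
have sB : {subset B <= A ++ B} by move=> z zB; rewrite mem_cat zB orbT.
have [ix iy] : x \in [:: x; y] /\ y \in [:: x; y] by rewrite !inE !eqxx orbT.
have dP : decomp [:: x :: A, y :: B & qs ++ ps] r.
  split=> [|p].
    rewrite (permPl SP) /= flatten_cat -QE; apply/seq.permP => a.
    by do ![rewrite /= ?count_cat]; rewrite (seq.permP PP) /= !count_cat; lia.
  rewrite !in_cons mem_cat => /or4P[/eqP->|/eqP->|pq|/psP //]; auto.
  apply: pP (qsP _ pq) => z zp; rewrite !in_cons !mem_cat QE.
  by have -> : z \in flatten qs; [apply/flattenP; exists p | rewrite !orbT].
have : perm_eq [:: color (x :: A); color (y :: B)] [:: color (y :: A); color (x :: B)].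
  apply: (exchange m_gt3 dP); rewrite ?size_cat ?szqs; [| |exact: pc|exact: pc].
    by move: szps k_gt2; lia.
  by apply/seq.permP => a; rewrite /= !count_cat /=; lia.
rewrite /color !big_cons => cP.
have pc0 a C : a \in [:: x; y] -> {subset C <= A ++ B} -> size C = (n - 1)%N ->
    phi (a + \sum_(z <- C) z) = 0.
  by move=> i s' z; have [_] := pc a C i s' z; rewrite big_cons.
(* By injectivity of [psi] on the kernel, the first alternative would give [x = y]; the second is
   the claim. *)
have : psi (x + \sum_(z <- A) z) \in
    [:: psi (y + \sum_(z <- A) z); psi (x + \sum_(z <- B) z)].
  by rewrite -(perm_mem cP) mem_head.
rewrite !inE => /orP[] /eqP /psi_inj.
  by move/(_ (pc0 _ _ ix sA szA) (pc0 _ _ iy sA szA))/addIr.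
by move/(_ (pc0 _ _ ix sA szA) (pc0 _ _ ix sB szB))/addrI.
Qed.

(** For [x <> y], [class_swap] applies with [u] completing [A] and [w] left in [Q], and also with
    [u] and [w] interchanged. Both times the completed sum equals that of [B], so [u = w]. Since
    [k > 2], [Q] has room for the spare element. *)
Lemma class_almost_const : exists z, ((k * n).-1 <= count_mem z P)%N.
Proof.
rewrite -szP; apply: almost_const => [|x y u w t PP].
  by rewrite szP; nia.
have [->|/eqP xy] := eqVneq x y; [by left | right].
have szt : (k * n = (size t).+4)%N by rewrite -szP (perm_size PP).
have kn : (k * n = n + n + (k - 2) * n)%N by rewrite -addnA -!mulSn; congr (_ * _)%N; lia.
have kn0 : (0 < (k - 2) * n)%N by rewrite muln_gt0 n_gt0 subn_gt0 k_gt2.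
pose A := take (n - 2) t; pose B := take (n - 1) (drop (n - 2) t).
pose Q := drop (n - 1) (drop (n - 2) t).
have tE : t = A ++ B ++ Q by rewrite !cat_take_drop.
have szA : size A = (n - 2)%N by rewrite size_takel //; lia.
have szB : size B = (n - 1)%N by rewrite size_takel // size_drop; lia.
have szQ : (size Q).+1 = ((k - 2) * n)%N by rewrite !size_drop; lia.
have sums v v' : perm_eq [:: u; w] [:: v; v'] ->
    v + \sum_(z <- A) z = \sum_(z <- B) z.
  move=> vv'; have := @class_swap x y (v :: A) B (v' :: Q).
  rewrite big_cons /= szA szB szQ; apply=> //; last by lia.
  rewrite (permPl PP) !perm_cons tE; apply/seq.permP => a.
  by have := seq.permP vv' a; rewrite /= !count_cat /=; lia.
apply: (addIr (\sum_(z <- A) z)); rewrite (sums u w) // (sums w u) //.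
by rewrite (perm_catC [:: u] [:: w]).
Qed.

End OneClass.

Hypothesis sH : forall s : seq H, (c * (n - 1) + n < size s)%N -> zero_sum_sub n s.

(** More than (c(m - 1) - 1)n elements are covered by pieces. So a remainder as small as greedy
    extraction with [sH] leaves already forces the maximal number of pieces, and Property D applies
    to their colors. *)
Lemma decomp_full ps r : decomp ps r -> (size r <= c * (n - 1) + n)%N ->
  size ps = (c * (m - 1))%N.
Proof.
move=> dP rb; apply/eqP; rewrite eqn_leq (decomp_size dP) /= -ltnS.
rewrite -(ltn_pmul2r n_gt0) mulSn; have := decomp_sizeE dP; rewrite szS.
have -> : (m * n - 1 = (m - 1) * n + (n - 1))%N.
  by case: m m_gt0 => // m' _; rewrite mulSn; lia.
by rewrite mulnDr mulnA; simpl in *; lia.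
Qed.

Lemma pieces_cat ps qs : (forall p, p \in ps -> piece p) -> (forall p, p \in qs -> piece p) ->
  forall p, p \in ps ++ qs -> piece p.
Proof. by move=> pP qP p; rewrite mem_cat => /orP[/pP|/qP]. Qed.

Lemma class_pieces h (s : seq G) k : all (of_class h) s -> size s = (k * n)%N ->
  exists ps, [/\ s = flatten ps, size ps = k & forall p, p \in ps -> piece p].
Proof.
move=> sh /chunks[ps [sE szps psP]]; exists ps; split=> // p pp.
apply: (@class_piece h); first exact: psP.
by apply/allP => x xp; apply: (allP sh); rewrite sE; apply/flattenP; exists p.
Qed.

Lemma classes_pieces (P : H -> seq G) (k : H -> nat) (hs : seq H) :
  (forall h, h \in hs -> all (of_class h) (P h) /\ size (P h) = (k h * n)%N) ->
  exists ps, flatten (map P hs) = flatten ps /\ forall p, p \in ps -> piece p.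
Proof.
elim: hs => [|h hs IH] hP; first by exists [::].
have [|ps [psE psP]] := IH; first by move=> g gh; apply: hP; rewrite in_cons gh orbT.
have [hh szh] := hP h (mem_head _ _).
have [qs [qE _ qP]] := class_pieces hh szh.
by exists (qs ++ ps); split; [rewrite flatten_cat /= qE psE | apply: pieces_cat].
Qed.

(* T ^ (n - 1) for the list T = hs *)
Definition reserve (hs : seq H) := flatten (nseq (n - 1) hs).

Lemma count_reserve hs h : count_mem h (reserve hs) = ((n - 1) * count_mem h hs)%N.
Proof. by rewrite /reserve; elim: (n - 1)%N => //= k IH; rewrite count_cat IH mulSn. Qed.

Lemma flatten_map_perm (P X Y : H -> seq G) (hs : seq H) :
  (forall h, h \in hs -> perm_eq (P h) (X h ++ Y h)) ->
  perm_eq (flatten (map P hs)) (flatten (map X hs) ++ flatten (map Y hs)).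
Proof.
elim: hs => //= h hs IH hP; apply/seq.permP => a; rewrite !count_cat.
rewrite (seq.permP (hP h (mem_head _ _))) count_cat.
rewrite (seq.permP (IH _)) ?count_cat; first by lia.
by move=> g gh; apply: hP; rewrite in_cons gh orbT.
Qed.

(** * Big classes *)

Section BigClasses.
Hypotheses (n_gt2 : (2 < n)%N) (ltnm : (n < m)%N).
Variable bs : seq H.
Hypothesis ubs : uniq bs.
Hypothesis bs_big : forall h, h \in bs -> (n * n <= count (of_class h) S)%N.
Hypothesis few_outside :
  (size (filter (fun x => phi x \notin bs) S) + 2 * size bs * n < (m - 1) * n)%N.

Lemma reserve_zero_sum_free : exists hs,
  [/\ {subset hs <= bs}, uniq hs, size hs = c & ~ zero_sum_sub n (reserve hs)].
Proof.
pose N := filter (fun x => phi x \notin bs) S.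
pose V h := filter (of_class h) S; pose k h := (size (V h) %/ n)%N.
pose P h := take (k h * n) (V h); pose B h := drop (k h * n) (V h).
have k_ge h : h \in bs -> (n <= k h)%N.
  by move=> /bs_big; rewrite -size_filter leq_divRL.
have Ph h : all (of_class h) (P h).
  by apply/allP => x /mem_take; rewrite mem_filter => /andP[].
have szP h : size (P h) = (k h * n)%N by rewrite size_takel // leq_divM.
have szB h : (size (B h) <= n - 1)%N.
  rewrite size_drop /k; have := ltn_pmod (size (V h)) n_gt0.
  by have := divn_eq (size (V h)) n; simpl in *; lia.
(* Two rounds of extraction, so that the pieces can be counted separately: [PN] by the size of [N],
   [mx] by the number of big classes. *)
have [PN [L [NP PNP Lb]]] := greedy_pieces N sH.
have [mx [R [mxP mxp Rb]]] := greedy_pieces (L ++ flatten (map B bs)) sH.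
have SP : perm_eq S (flatten (map P bs) ++ flatten (PN ++ mx) ++ R).
  have SV : perm_eq S (N ++ flatten (map V bs)) := perm_fibers phi S ubs.
  rewrite (permPl SV).
  have /seq.permP VP : perm_eq (flatten (map V bs)) (flatten (map P bs) ++ flatten (map B bs)).
    by apply: flatten_map_perm => h _; rewrite cat_take_drop.
  apply/seq.permP => a; have := VP a; have := seq.permP NP a; have := seq.permP mxP a.
  by rewrite flatten_cat !count_cat; simpl in *; lia.
(* Cutting the other classes arbitrarily completes [P h] to a full decomposition, so
   [class_almost_const] applies. Only [(k h - 1) * n] copies of [z] are kept: the rest then has [n]
   elements and is itself a piece. *)
have Pk h : h \in bs -> exists zE : G * seq G,
    perm_eq (P h) (nseq ((k h - 1) * n) zE.1 ++ zE.2).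
  move=> hb.
  have [ps [psE psP]] := @classes_pieces P k (rem h bs) (fun g _ => conj (Ph g) (szP g)).
  have SP' : perm_eq S (P h ++ flatten (ps ++ (PN ++ mx)) ++ R).
    rewrite (permPl SP) (flatten_cat ps) -psE; apply/seq.permP => a.
    have /seq.permP/(_ a) := perm_flatten (perm_map P (perm_to_rem hb)).
    by rewrite /= !count_cat; lia.
  have psP' := pieces_cat psP (pieces_cat PNP mxp).
  have [qs [qE szq qP]] := class_pieces (Ph h) (szP h).
  have dP : decomp (qs ++ (ps ++ (PN ++ mx))) R.
    split; last exact: pieces_cat.
    by rewrite (permPl SP') [flatten (qs ++ _)]flatten_cat qE -catA.
  have := decomp_full dP Rb; rewrite size_cat szq => szk.
  have [|||z zP] := class_almost_const _ _ _ SP' (Ph h) (szP h) psP' szk.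
  - by apply: ltnW.
  - by apply: leq_trans ltnm.
  - by apply: leq_trans (k_ge h hb).
  have [|E PE] := @perm_nseq_count _ (P h) z ((k h - 1) * n).
    by apply: leq_trans zP; rewrite mulnBl; lia.
  by exists (z, E).
have ch h : exists zE : G * seq G,
    h \in bs -> perm_eq (P h) (nseq ((k h - 1) * n) zE.1 ++ zE.2).
  have [hb|_] := boolP (h \in bs); last by exists (0, [::]).
  by have [zE zEP] := Pk h hb; exists zE.
have [zE zEP] := choice ch.
pose z h := (zE h).1; pose E h := (zE h).2.
have zEh h : h \in bs -> all (of_class h) (nseq ((k h - 1) * n) (z h) ++ E h).
  by move=> hb; rewrite -(perm_all _ (zEP h hb)).
have szE h : h \in bs -> size (E h) = n.
  move=> hb; have := perm_size (zEP h hb); have := k_ge h hb.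
  rewrite szP size_cat size_nseq mulnBl mul1n => k_gt kn.
  have le : (n <= k h * n)%N by rewrite leq_pmull //; lia.
  by apply/eqP; rewrite -(eqn_add2l (k h * n - n)) -kn subnK.
have zh h : h \in bs -> phi (z h) = h.
  move=> hb; have := zEh h hb; rewrite all_cat => /andP[+ _].
  rewrite all_nseq => /orP[|/eqP //]; rewrite muln_eq0.
  by have := k_ge h hb; lia.
pose pm h := nseq n (z h).
have pmP h : h \in bs -> piece (pm h).
  move=> hb; apply: (@class_piece h); first by rewrite size_nseq.
  by rewrite all_nseq /of_class zh // eqxx orbT.
pose Hm := flatten [seq nseq (k h - 1) h | h <- bs].
have Hmb : {subset Hm <= bs}.
  by move=> h /flatten_mapP[g gb]; rewrite mem_nseq => /andP[_ /eqP ->].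
have HmE : flatten (map pm Hm) = flatten [seq nseq ((k h - 1) * n) (z h) | h <- bs].
  rewrite /Hm; elim: {+}bs => //= h hs IH; rewrite map_cat flatten_cat IH map_nseq.
  congr (_ ++ _); elim: (k h - 1)%N => //= j ->.
  by rewrite mulSn nseqD.
pose rest := map E bs ++ (PN ++ mx).
have restP p : p \in rest -> piece p.
  apply: pieces_cat; last exact: pieces_cat.
  move=> q /mapP[h hb ->]; apply: (@class_piece h); first exact: szE.
  by have := zEh h hb; rewrite all_cat => /andP[].
have mainP hs : {subset hs <= bs} -> forall p, p \in map pm hs -> piece p.
  by move=> sub p /mapP[h /sub hb ->]; apply: pmP.
have dP : decomp (map pm Hm ++ rest) R.
  split; last exact: pieces_cat (mainP _ Hmb) restP.
  rewrite (permPl SP) (flatten_cat (map pm Hm)) HmE (flatten_cat _ (PN ++ mx)) -!catA.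
  by rewrite [X in perm_eq _ X]catA perm_cat2r; apply: flatten_map_perm.
pose col h := color (pm h).
have colE hs : map color (map pm hs) = map col hs by rewrite -map_comp.
have szD := decomp_full dP Rb.
(* With fewer than [c] colors, each used at most [m - 1] times, the pure pieces number at most (c -
   1)(m - 1). The missing [m - 1] pieces would come from [E], [mx] and [PN], which [few_outside]
   makes too few. *)
have le_col : (c <= size (undup (map col bs)))%N.
  rewrite leqNgt; apply/negP => lt.
  (* [L] exceeds [R] by less than [n] elements and each [B h] adds at most [n - 1]. *)
  have szmx : (size mx <= size bs)%N.
    have := perm_size mxP; rewrite !size_cat (@size_flatten_const _ n mx) => [|p /mxp[] //].
    have lt_R := remainder_gt dP szS.
    have le_B : (size (flatten (map B bs)) <= size bs * (n - 1))%N.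
      by rewrite -(size_map B); apply: size_flatten_le => p /mapP[h _ ->].
    have le_bs : (size bs * (n - 1) <= size bs * n)%N by rewrite leq_mul2l leq_subr orbT.
    by move=> szE'; rewrite -ltnS -(ltn_pmul2r n_gt0) mulSn; simpl in *; lia.
  have szPN : (size PN * n <= size N)%N.
    rewrite (perm_size NP) size_cat (@size_flatten_const _ n PN) ?leq_addr // => p /PNP[] //.
  have szHm : (size Hm <= (m - 1) * size (undup (map col bs)))%N.
    rewrite -(size_map col); apply: size_le_count_subset => [t|t].
      by rewrite mem_undup => /mapP[h /Hmb hb ->]; rewrite map_f.
    by have := decomp_count t dP; rewrite map_cat count_cat colE; apply: leq_trans;
      rewrite leq_addr.
  move: szD; rewrite !size_cat !size_map => szD.
  have : (size Hm <= (m - 1) * (c - 1))%N.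
    by apply: leq_trans szHm _; rewrite leq_mul2l; apply/orP; right; lia.
  move: few_outside; rewrite -/N => few szHm'.
  have : ((m - 1) * n <= (2 * size bs + size PN) * n)%N.
    rewrite leq_mul2r; apply/orP; right.
    move: szD szHm'; case: c lt => // c' _; rewrite mulSn subSS subn0 mulnC.
    by simpl in *; lia.
  by rewrite mulnDl; simpl in *; lia.
have [hs [hsb szhs ucol]] := exists_distinct_images le_col.
have uhs := map_uniq ucol.
exists hs; split=> // -[W [U [WP szW W0]]].
have Whs w : w \in W -> w \in hs.
  move=> wW; have : w \in reserve hs by rewrite (perm_mem WP) mem_cat wW.
  by move=> /flattenP[q]; rewrite mem_nseq => /andP[_ /eqP->].
have Wc w : (count_mem w W <= n - 1)%N.
  apply: (@leq_trans (count_mem w (reserve hs))).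
    by rewrite (seq.permP WP) count_cat leq_addr.
  by rewrite count_reserve count_uniq_mem // -[leqRHS]muln1 leq_mul2l leq_b1 orbT.
(* Each [w] occurs at most [n - 1] times in [W] and [k w - 1 >= n - 1] times in [Hm]. *)
have [Hm' HmP] : exists u, perm_eq Hm (W ++ u).
  apply: count_submset => w; have [wW|wW] := boolP (w \in W); last by rewrite (count_memPn wW).
  apply: leq_trans (Wc w) _; have wb := hsb _ (Whs _ wW).
  apply: (@leq_trans (k w - 1)); first by have := k_ge w wb; lia.
  rewrite /Hm (seq.permP (perm_flatten (perm_map _ (perm_to_rem wb)))) /= count_cat.
  by rewrite count_nseq /= eqxx mul1n leq_addr.
pose rest' := map pm Hm' ++ rest.
have dP1 : decomp (map pm W ++ rest') R.
  by apply: decomp_perm dP; rewrite /rest' catA -map_cat perm_cat2r; apply: perm_map.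
have szD1 := decomp_full dP1 Rb.
have zWP : piece (map z W).
  split; first by rewrite size_map.
  rewrite big_map raddf_sum /= big_seq (eq_bigr id) => [|w wW]; first by rewrite -big_seq.
  by rewrite zh //; apply/hsb/Whs.
(* The same elements regrouped: the [n] pieces [pm w], for [w] in [W], become [n] copies of
   [map z W]. *)
have dP2 : decomp (nseq n (map z W) ++ rest') R.
  case: dP1 => SP1 P1; split; last first.
    apply: pieces_cat => p; first by rewrite mem_nseq => /andP[_ /eqP->].
    by move=> pr; apply: P1; rewrite mem_cat pr orbT.
  rewrite (permPl SP1) perm_cat2r !flatten_cat perm_cat2r; apply/seq.permP => a.
  rewrite !count_flatten -map_comp map_nseq sumn_nseq count_map.
  elim: {+}W => /= [|w W' IH]; first by rewrite mul0n.
  by rewrite IH count_nseq mulnDl.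
have szD2 := decomp_full dP2 Rb.
clearbody rest'.
have [w0 w0W] : exists w, w \in W.
  by case: {+}W szW n_gt2 => [<- //|w W' _ _]; exists w; rewrite mem_head.
have dv1 := decomp_dvd (col w0) dP1 szD1.
have dv2 := decomp_dvd (col w0) dP2 szD2.
move: dv1 dv2; rewrite !map_cat !(count_cat _ _ (map color rest')) colE.
have -> : count_mem (col w0) (map col W) = count_mem w0 W.
  rewrite count_map; apply: eq_in_count => w /Whs wh /=.
  by rewrite (inj_in_eq (uniq_map_inj_in ucol)) // Whs.
rewrite map_nseq count_nseq.
have w0n := Wc w0; have w0gt : (0 < count_mem w0 W)%N by rewrite -has_count has_pred1.
(* The regrouping changes the multiplicity of [col w0] from [w + e] to [n + e] or [e]. The
   difference, [n - w] or [w], lies strictly between 0 and [m - 1], since [0 < w < n < m]. *)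
set w := count_mem w0 W in w0n w0gt *; set e := count _ _; case: (pred1 _ _) => d1 d2.
  have : (m - 1 %| (1 * n + e) - (w + e))%N by rewrite dvdn_sub.
  by rewrite subnDr => /dvdn_leq; rewrite subn_gt0; lia.
have : (m - 1 %| (w + e) - (0 * n + e))%N by rewrite dvdn_sub.
by rewrite subnDr mul0n subn0 => /dvdn_leq; lia.
Qed.

End BigClasses.

(** * Absorbing the elements outside the big classes *)

Hypothesis D0 : forall (g : H) (T : seq H), size T = c -> zero_sum_sub n (g :: reserve T).

(* If the reserve itself has no zero-sum subsequence of length n, then the one
   provided by D0 for phi g :: reserve hs has to use phi g. *)
Lemma consume (hs : seq H) (L X : seq G) : size hs = c -> uniq hs ->
  ~ zero_sum_sub n (reserve hs) -> (forall x, x \in X -> phi x \in hs) ->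
  (forall h, h \in hs -> ((n - 1) * size L <= count (of_class h) X)%N) ->
  exists ps r, [/\ perm_eq (L ++ X) (flatten ps ++ r), forall p, p \in ps -> piece p &
    forall x, x \in r -> phi x \in hs].
Proof.
move=> szhs uhs free; elim: L X => [|g L IH] X Xhs Xcount; first by exists [::], X.
have res_le h : (count_mem h (reserve hs) <= n - 1)%N.
  by rewrite count_reserve count_uniq_mem // -[leqRHS]muln1 leq_mul2l leq_b1 orbT.
have [t [u [tP szt t0]]] := D0 (phi g) szhs.
have [gt|gt] := boolP (phi g \in t); last first.
  have : phi g \in t ++ u by rewrite -(perm_mem tP) mem_head.
  rewrite mem_cat (negPf gt) /= => /perm_to_rem uP; case: free; exists t, (rem (phi g) u).
  split=> //; rewrite -(perm_cons (phi g)) (permPl tP) -[phi g :: _]cat1s perm_sym.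
  by rewrite perm_catCA perm_cat2l perm_sym.
have tP' := perm_to_rem gt; set t' := rem _ _ in tP'.
have resP : perm_eq (reserve hs) (t' ++ u).
  by rewrite -(perm_cons (phi g)) (permPl tP) -cat_cons perm_cat2r.
have t'_le h : (count_mem h t' <= count_mem h (reserve hs))%N.
  by rewrite (seq.permP resP) count_cat leq_addr.
have [u' XP] : exists u', perm_eq (map phi X) (t' ++ u').
  apply: count_submset => h; apply: leq_trans (t'_le h) _.
  have [hhs|/count_memPn hhs] := boolP (h \in hs); last by rewrite count_reserve hhs muln0.
  apply: leq_trans (res_le h) _; rewrite count_map.
  by apply: leq_trans (Xcount h hhs); rewrite leq_pmulr.
have [X1 [X2 [XP' X1t _]]] := perm_map_catE XP.
have [h hhs|h hhs|ps [r [rP psP rhs]]] := IH X2.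
- by apply: Xhs; rewrite (perm_mem XP') mem_cat hhs orbT.
(* As [hs] has no repetitions, the piece of [g] takes at most [n - 1] elements from each class,
   which is the budget per element of [L]. *)
- have X1_le : (count (of_class h) X1 <= n - 1)%N.
    have -> : count (of_class h) X1 = count_mem h t' by rewrite -X1t count_map.
    exact: leq_trans (t'_le h) (res_le h).
  by have := Xcount h hhs; rewrite (seq.permP XP') count_cat /= mulnS; lia.
exists ((g :: X1) :: ps), r; split=> // [|p].
  apply/seq.permP => a; have := seq.permP rP a; have := seq.permP XP' a.
  by rewrite /= !count_cat; simpl in *; lia.
rewrite in_cons => /predU1P[->|/psP //]; split.
  by have := perm_size tP'; rewrite szt /= -X1t size_map.
by rewrite raddf_sum -(big_map phi predT id) /= X1t -(perm_big _ tP').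
Qed.

Lemma classes_remainder (hs : seq H) (X : seq G) : (forall x, x \in X -> phi x \in hs) ->
  exists ps r, [/\ perm_eq X (flatten ps ++ r), forall p, p \in ps -> piece p &
    (size r <= size hs * (n - 1))%N].
Proof.
elim: hs X => [|h hs IH] X Xhs.
  by case: X Xhs => [|x X /(_ x (mem_head _ _))] //; exists [::], [::].
have [x|ps [r [rP psP r_le]]] := IH (filter (predC (of_class h)) X).
  rewrite mem_filter => /andP[/= xh /Xhs]; rewrite in_cons.
  by rewrite -[phi x == h]/(of_class h x) (negPf xh).
set V := filter (of_class h) X; pose k := (size V %/ n)%N.
have Vh : all (of_class h) (take (k * n) V).
  by apply/allP => x /mem_take; rewrite mem_filter => /andP[].
have [|qs [qE _ qP]] := class_pieces (k := k) Vh; first by rewrite size_takel // leq_divM.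
exists (qs ++ ps), (drop (k * n) V ++ r); split.
- have XP : perm_eq X (V ++ filter (predC (of_class h)) X).
    by rewrite perm_sym; apply/permPl/perm_filterC.
  rewrite (permPl XP).
  rewrite flatten_cat -qE; apply/seq.permP => a; have := seq.permP rP a.
  by rewrite -/V -[in count a (V ++ _)](cat_take_drop (k * n) V) !count_cat; simpl in *; lia.
- exact: pieces_cat.
rewrite size_cat /= mulSn leq_add // size_drop /k.
have := ltn_pmod (size V) n_gt0; have := divn_eq (size V) n; simpl in *; lia.
Qed.

(** At most c(n - 1) + n elements outside the classes in [hs] escape greedy extraction; the size of
    these classes suffices to [consume] all of them. Cutting up what is left inside the [c] classes
    leaves at most c(n - 1) elements, against [remainder_gt]. *)
Lemma big_classes_absurd (hs : seq H) : uniq hs -> size hs = c ->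
  (forall h, h \in hs -> ((c * (n - 1) + n) * (n - 1) <= count (of_class h) S)%N) ->
  ~ zero_sum_sub n (reserve hs) -> False.
Proof.
move=> uhs szhs big free.
pose N := filter (fun x => phi x \notin hs) S; pose X := filter (fun x => phi x \in hs) S.
have [PN [L [NP PNP Lb]]] := greedy_pieces N sH.
have [x|h hhs|ps [r [rP psP rhs]]] := consume (L := L) (X := X) szhs uhs free.
- by rewrite mem_filter => /andP[].
- apply: (@leq_trans (count (of_class h) S)).
    by apply: leq_trans (big h hhs); rewrite mulnC leq_mul2r Lb orbT.
  rewrite count_filter; apply: eq_leq; apply: eq_count => x /=.
  by rewrite /of_class; case: eqP => //= ->; rewrite hhs.
have [qs [R [RP qsP R_le]]] := classes_remainder rhs.
have dP : decomp (PN ++ ps ++ qs) R.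
  split; last by do 2?apply: pieces_cat.
  have SP : perm_eq S (X ++ N).
    by rewrite perm_sym; apply/permPl/(perm_filterC (fun x => phi x \in hs)).
  rewrite (permPl SP) !flatten_cat; apply/seq.permP => a.
  have := seq.permP NP a; have := seq.permP rP a; have := seq.permP RP a.
  by rewrite !count_cat; simpl in *; lia.
by have := remainder_gt dP szS; rewrite ltnNge -szhs R_le.
Qed.

End NoZeroSum.

(** * Assembling the descent *)

Hypothesis DK : forall s : seq K, size s = (c * (m - 1))%N -> ~ zero_sum_sub m s ->
  forall t, (m - 1 %| count_mem t s)%N.
Hypothesis sH : forall s : seq H, (c * (n - 1) + n < size s)%N -> zero_sum_sub n s.
Hypothesis D0 : forall (g : H) (T : seq H), size T = c -> zero_sum_sub n (g :: reserve T).

Lemma size_classes (A : {set H}) (S : seq G) :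
  size (filter (fun x => phi x \in A) S) = (\sum_(h in A) count (of_class h) S)%N.
Proof.
rewrite size_filter -sum1_count (partition_big phi (mem A)) //=.
apply: eq_bigr => h hA; rewrite -sum1_count; apply: eq_bigl => x.
by rewrite /of_class; case: eqP => [->|]; rewrite ?hA ?andbF.
Qed.

(** Greedy extraction alone leaves a remainder contradicting [remainder_gt]; this settles
    [n <= 2]. *)
Lemma descent_no_slack (S : seq G) :
  (forall s : seq H, (c * (n - 1) < size s)%N -> zero_sum_sub n s) ->
  size S = (c * (m * n - 1) + 1)%N -> zero_sum_sub (m * n) S.
Proof.
move=> sH' szS; apply: contrapT => noS.
have [ps [r [SP psP rle]]] := greedy_pieces S sH'.
by have := remainder_gt noS (conj SP psP) szS; rewrite ltnNge rle.
Qed.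

Lemma descent (S : seq G) : (0 < c)%N -> (2 < n)%N -> ((c - 1) ^ 2 < n)%N -> (n <= #|H|)%N ->
  ((c * (n - 1) + n) * (n - 1) * (#|H| - (c - 1)) + (c - 1) ^ 2 * m <= m * n + (c - 1) ^ 2)%N ->
  size S = (c * (m * n - 1) + 1)%N -> zero_sum_sub (m * n) S.
Proof.
move=> c_gt0 n_gt2 c_lt n_le m_ge szS; apply: contrapT => noS.
have cE : c = (c - 1).+1 by lia.
set d := (c - 1)%N in cE c_lt m_ge; set M := ((c * (n - 1) + n) * (n - 1))%N.
rewrite cE in m_ge.
have ltnm := n_lt_m n_gt2 c_lt n_le m_gt0 m_ge.
pose B := [set h | (M <= count (of_class h) S)%N].
have small_le h : h \in ~: B -> (count (of_class h) S <= M - 1)%N by rewrite !inE; lia.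
have out_le : (size (filter (fun x => phi x \in ~: B) S) <= (#|H| - #|B|) * (M - 1))%N.
  rewrite size_classes; apply: (@leq_trans (\sum_(h in ~: B) (M - 1))%N); first exact: leq_sum.
  by rewrite sum_nat_const cardsCs setCK.
have in_le : (size (filter (fun x => phi x \in B) S) <=
    #|B| * (m * n - 1 + d * (m - 1)))%N.
  rewrite size_classes -sum_nat_const; apply: leq_sum => h _.
  rewrite leqNgt; apply/negP => lt; apply: noS.
  apply: (@zero_sum_sub_cat _ _ _ (filter (of_class h) S) (filter (predC (of_class h)) S)).
    by rewrite perm_sym; apply/permPl/perm_filterC.
  apply: (@class_bound h); first exact: filter_all.
  rewrite size_filter; apply: leq_trans lt; rewrite -/d.
  have : (0 < m * n)%N by rewrite muln_gt0 m_gt0.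
  by lia.
have le_B : (c <= #|B|)%N.
  rewrite leqNgt cE ltnS; apply/negP => B_le.
  have := many_big_classes n_gt2 c_lt n_le m_gt0 m_ge (erefl _) B_le.
  rewrite -[X in (X * (m * n - 1))%N]cE -szS ltnNge => /negP; apply.
  have -> : size S = (size (filter (fun x => phi x \in B) S) +
                      size (filter (fun x => phi x \in ~: B) S))%N.
    rewrite -[LHS](count_predC (fun x => phi x \in B)) !size_filter; congr addn.
    by apply: eq_count => x; rewrite /= in_setC.
  by apply: leq_add; rewrite // -cE.
have BH : (#|B| <= #|H|)%N by exact: max_card.
have [|h hB||hs [hsB uhs szhs free]] :=
  @reserve_zero_sum_free S noS szS DK sH n_gt2 ltnm (enum B).
- exact: enum_uniq.
- rewrite mem_enum inE in hB; apply: leq_trans hB.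
  by rewrite /M cE; apply: threshold_ge_sqr.
- rewrite -cardE (eq_filter (a2 := fun x => phi x \in ~: B)) => [|x]; last first.
    by rewrite mem_enum in_setC.
  apply: leq_ltn_trans (few_small_classes n_gt2 c_lt n_le m_gt0 m_ge _ BH); last by rewrite -cE.
  by rewrite leq_add2r -cE.
apply: (big_classes_absurd noS szS sH D0 uhs szhs) free => h /hsB.
by rewrite mem_enum inE.
Qed.

End Descent.

(** * Multisets over powers of cyclic groups *)

Section Multisets.
Variable A : finZmodType.
Local Open Scope mset_scope.

Lemma zero_sum_subseq_mset k (X : seq A) :
  has_zero_sum_subseq k (seq_mset X) <-> zero_sum_sub k X.
Proof.
split=> [[T [/msubsetP TX szT T0]] | [t [u [XP szt t0]]]].
  have [|u XP] := @count_submset _ X T; last by exists T, u.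
  by move=> x; rewrite count_mem_mset -(mset_seqE X).
have tP := perm_eq_seq_mset t; exists (seq_mset t); split.
- by apply/msubsetP => x; rewrite !mset_seqE (seq.permP XP) count_cat leq_addr.
- by rewrite (perm_size tP).
- by rewrite (perm_big _ tP).
Qed.

Lemma s_zero_sum (X : seq A) : s A <= size X -> zero_sum_sub (exponent [set: A]) X.
Proof.
rewrite /s; case: ex_minnP => l /asboolP[_ sP] _ le.
by apply/zero_sum_subseq_mset/sP; rewrite (perm_size (perm_eq_seq_mset X)).
Qed.

Lemma s_minimal l : 0 < l ->
  (forall X : seq A, size X = l -> zero_sum_sub (exponent [set: A]) X) -> s A <= l.
Proof.
move=> l_gt0 lP; rewrite /s; case: ex_minnP => k _; apply; apply/asboolP; split=> // X leX.
rewrite -(seq_mset_id X); apply/zero_sum_subseq_mset.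
apply: (@zero_sum_sub_cat _ _ _ (take l X) (drop l X)); first by rewrite cat_take_drop.
by apply: lP; rewrite size_takel.
Qed.

Lemma mset_powE (T : {mset A}) k x : mset_pow T k x = k * T x.
Proof. by rewrite /mset_pow; elim: k => [|k IH]; rewrite ?mset0E //= msetE2 IH mulSn. Qed.

Lemma mset_pow_seq (T : seq A) k :
  mset_pow (seq_mset T) k = seq_mset (flatten (nseq k T)).
Proof.
apply/msetP => x; rewrite mset_powE !mset_seqE.
by elim: k => //= k IH; rewrite count_cat -IH mulSn.
Qed.

End Multisets.

(** * Exponent of $C_n^r$, and the maps [phi] and [psi] on $C_{mn}^r$ *)

Section CyclicPowers.
Local Open Scope ring_scope.

Lemma val_mulrn_Zp p (x : 'I_p.+1) k : nat_of_ord (x *+ k) = (x * k %% p.+1)%N.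
Proof.
elim: k => [|k IH]; first by rewrite muln0 mod0n.
by rewrite mulrSr /= IH mulnSr modnDml.
Qed.

Lemma Cnr_mulrn n r (x : Cnr n r) : (0 < n)%N -> x *+ n = 0.
Proof.
case: n x => // n x _; apply/rowP => j; rewrite mulmxnE mxE; apply/val_inj.
by rewrite /= val_mulrn_Zp modnMl.
Qed.

Lemma exponent_Cnr n r : (0 < n)%N -> (0 < r)%N -> exponent [set: Cnr n r] = n.
Proof.
move=> n_gt0 r_gt0; apply/eqP; rewrite eqn_dvd; apply/andP; split.
  by apply/exponentP => x _; rewrite FinRing.zmodXgE Cnr_mulrn.
case: r r_gt0 => // r _; case: n n_gt0 => // n _.
(* The all-ones vector has order [n]. *)
have := expg_exponent (in_setT (const_mx (inZp 1) : Cnr n.+1 r.+1)).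
rewrite FinRing.zmodXgE => /matrixP/(_ 0 0); rewrite mulmxnE !mxE => /(congr1 val) /=.
by rewrite val_mulrn_Zp /= modnMml mul1n => /eqP.
Qed.

Lemma card_Cnr n r : (0 < n)%N -> #|Cnr n r| = (n ^ r)%N.
Proof. by move=> n_gt0; rewrite card_mx card_ord mul1n prednK. Qed.

Definition Cnr_mod m n r (x : Cnr (m.+1 * n.+1) r) : Cnr n.+1 r :=
  \row_j inZp (x 0 j).
(** Meaningful on the kernel of [Cnr_mod], where every coordinate is a multiple of [n.+1]: there it
    is additive and injective. *)
Definition Cnr_div m n r (x : Cnr (m.+1 * n.+1) r) : Cnr m.+1 r :=
  \row_j inZp (x 0 j %/ n.+1).

Lemma Cnr_modD m n r : {morph @Cnr_mod m n r : x y / x + y}.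
Proof.
move=> x y; apply/rowP => j; rewrite !mxE; apply: val_inj => /=.
by rewrite -[(n + _).+1]/(m.+1 * n.+1)%N modn_dvdm ?dvdn_mull // modnDm.
Qed.

Lemma Cnr_modB m n r : zmod_morphism (@Cnr_mod m n r).
Proof. by move=> x y; apply: (addIr (Cnr_mod y)); rewrite -Cnr_modD !subrK. Qed.

HB.instance Definition _ m n r :=
  GRing.isZmodMorphism.Build _ _ (@Cnr_mod m n r) (@Cnr_modB m n r).

Lemma Cnr_mod0 m n r (x : Cnr (m.+1 * n.+1) r) : Cnr_mod x = 0 ->
  forall j, (n.+1 %| x 0%R j)%N.
Proof. by move=> /rowP x0 j; have := x0 j; rewrite !mxE => /(congr1 val) /= /eqP. Qed.

Lemma Cnr_divD m n r (x y : Cnr (m.+1 * n.+1) r) : Cnr_mod x = 0 -> Cnr_mod y = 0 ->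
  Cnr_div (x + y) = Cnr_div x + Cnr_div y.
Proof.
move=> /Cnr_mod0 x0 /Cnr_mod0 y0; apply/rowP => j; rewrite !mxE; apply: val_inj => /=.
have /dvdnP[a ->] := x0 j; have /dvdnP[b ->] := y0 j.
rewrite -mulnDl !mulnK // modnDm.
by rewrite -[(n + _).+1]/(m.+1 * n.+1)%N -muln_modl mulnK // modn_mod.
Qed.

Lemma Cnr_div_inj0 m n r (x : Cnr (m.+1 * n.+1) r) : Cnr_mod x = 0 -> Cnr_div x = 0 -> x = 0.
Proof.
move=> /Cnr_mod0 x0 /rowP d0; apply/rowP => j; rewrite !mxE; apply: val_inj => /=.
have := d0 j; rewrite !mxE => /(congr1 val) /=.
have : (x 0%R j < m.+1 * n.+1)%N := ltn_ord _; have /dvdnP[a ->] := x0 j.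
by rewrite mulnK // ltn_pmul2r // => /modn_small-> ->.
Qed.

End CyclicPowers.

(** Clears the positive denominator and moves the subtracted squares across; the remaining
    natural-number subtractions agree with the rational ones because [c - 1 <= q] and [c], [n] are
    positive. *)
Lemma rat_bound_nat (c m n q : nat) : (c - 1) ^ 2 < n -> c - 1 <= q ->
  (((c%:R * (n%:R - 1) + n%:R) * (n%:R - 1) * (q%:R - (c%:R - 1)) - (c%:R - 1) ^+ 2)
     / (n%:R - (c%:R - 1) ^+ 2) <= m%:R :> rat)%R -> 0 < c ->
  (c * (n - 1) + n) * (n - 1) * (q - (c - 1)) + (c - 1) ^ 2 * m <= m * n + (c - 1) ^ 2.
Proof.
move=> d_lt dq + c_gt0; have n_gt0 : 0 < n by apply: leq_trans d_lt.
have cE : (c%:R - 1 = (c - 1)%:R :> rat)%R by rewrite natrB.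
have nE : (n%:R - 1 = (n - 1)%:R :> rat)%R by rewrite natrB.
have qE : (q%:R - (c - 1)%:R = (q - (c - 1))%:R :> rat)%R by rewrite (natrB _ dq).
rewrite cE nE qE -!(natrM, natrX, natrD) -(natrB _ (ltnW d_lt)).
rewrite Num.Theory.ler_pdivrMr; last by rewrite Num.Theory.ltr0n subn_gt0.
rewrite Num.Theory.lerBlDr -natrM -natrD Num.Theory.ler_nat mulnBr.
have : m * (c - 1) ^ 2 <= m * n by rewrite leq_mul2l ltnW ?orbT.
by rewrite [_ * m]mulnC; lia.
Qed.

(** * Application of the descent to $C_{mn}^r$ *)

Local Open Scope ring_scope.

Theorem theorem1p1 (m n r c : nat)
  (m_gt0 : (0 < m)%N) (n_gt0 : (0 < n)%N)
  (r_gt0 : (0 < r)%N) (c_gt0 : (0 < c)%N)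
  (Dm : property_D_wrt m r c) (D0n : property_D0_wrt n r c)
  (s_le : (s (Cnr n r) <= c * (n - 1) + n + 1)%N)
  (n_ge : ((c - 1) ^ 2 + 1 <= n)%N)
  (m_ge : ((c%:R * (n%:R - 1) + n%:R) * (n%:R - 1) * (n%:R ^+ r - (c%:R - 1))
            - (c%:R - 1) ^+ 2) / (n%:R - (c%:R - 1) ^+ 2) <= m%:R :> rat) :
  (s (Cnr (m * n) r) <= c * (m * n - 1) + 1)%N.
Proof.
have sn (X : seq (Cnr n r)) : (s (Cnr n r) <= size X)%N -> zero_sum_sub n X.
  by move=> /s_zero_sum; rewrite exponent_Cnr.
have sH X (szX : (c * (n - 1) + n < size X)%N) : zero_sum_sub n (X : seq (Cnr n r)).
  by apply: sn; apply: leq_trans s_le _; rewrite addn1.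
have [Dm0 sm] := Dm.
have sK X : (c * (m - 1) < size X)%N -> zero_sum_sub m (X : seq (Cnr m r)).
  by rewrite -addn1 -sm => /s_zero_sum; rewrite exponent_Cnr.
have DK (X : seq (Cnr m r)) : size X = (c * (m - 1))%N -> ~ zero_sum_sub m X ->
    forall t, (m - 1 %| count_mem t X)%N.
  move=> szX free t; have [||T XE] := Dm0 (seq_mset X).
  - by rewrite (perm_size (perm_eq_seq_mset X)) szX sm addnK.
  - by move/zero_sum_subseq_mset.
  by rewrite -mset_seqE XE mset_powE dvdn_mulr.
have D0 g (T : seq (Cnr n r)) : size T = c -> zero_sum_sub n (g :: reserve n T).
  move=> szT; apply/zero_sum_subseq_mset; rewrite mset_cons -mset_pow_seq; apply: D0n.
  by rewrite (perm_size (perm_eq_seq_mset T)).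
apply: s_minimal => [|X szX]; first by rewrite addn1.
rewrite exponent_Cnr ?muln_gt0 ?m_gt0 //.
have [n_le2|n_gt2] := leqP n 2.
  (* For [n = 1] a single element has sum 0. For [n = 2] the sequence $gT^{n-1}$ of D0 is $gT$, that
     is, any sequence of length [c + 1]. *)
  have sH' (Y : seq (Cnr n r)) : (c * (n - 1) < size Y)%N -> zero_sum_sub n Y.
    case: Y => [//|g Y] lt.
    have [n1|n2] : n = 1%N \/ n = 2%N by lia.
      exists [:: g], Y; split; rewrite ?n1 // big_seq1.
      by rewrite -[g]mulr1n -[X in g *+ X]n1 Cnr_mulrn.
    apply: (@zero_sum_sub_cat _ _ _ (g :: take c Y) (drop c Y)).
      by rewrite /= cat_take_drop.
    have n1 : (n - 1 = 1)%N by lia.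
    have := D0 g (take c Y); rewrite /reserve n1 /= cats0; apply.
    by rewrite size_takel //; move: lt; rewrite n1 muln1.
  move: m n m_gt0 n_gt0 X szX sK sH' {Dm D0n s_le n_ge m_ge sn sH Dm0 sm DK D0 n_le2}.
  move=> [|m'] [|n'] // _ _ X szX sK sH'.
  exact: (@descent_no_slack _ _ _ (@Cnr_mod m' n' r) (@Cnr_div m' n' r) m'.+1 n'.+1 c isT isT
    (@Cnr_divD m' n' r) (@Cnr_div_inj0 m' n' r) sK X sH' szX).
have n_le : (n <= n ^ r)%N by rewrite -{1}(expn1 n) leq_pexp2l.
have d_lt : ((c - 1) ^ 2 < n)%N by rewrite -addn1.
have dq : (c - 1 <= n ^ r)%N.
  by apply: leq_trans n_le; apply: leq_trans (ltnW d_lt); apply: d_le_sqr.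
rewrite -natrX in m_ge; have := rat_bound_nat d_lt dq m_ge c_gt0.
move: m n m_gt0 n_gt0 X szX sK sH DK D0 n_gt2 n_le d_lt {Dm D0n s_le n_ge m_ge sn Dm0 sm dq}.
move=> [|m'] [|n'] // _ _ X szX sK sH DK D0 n_gt2 n_le d_lt bound.
apply: (@descent _ _ _ (@Cnr_mod m' n' r) (@Cnr_div m' n' r) m'.+1 n'.+1 c isT isT
  (@Cnr_divD m' n' r) (@Cnr_div_inj0 m' n' r)); rewrite ?card_Cnr //.
- by move=> x; apply: Cnr_mulrn.
- by move=> x; apply: Cnr_mulrn.
- by move=> x; apply: Cnr_mulrn.
Qed.
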